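(* Let $\mathcal{V},\mathcal{Q}$ be Hilbert spaces, $\mathcal{T}:\mathcal{V}\to\mathcal{Q}$ a bounded surjective linear map, $a:\mathcal{V}\times\mathcal{V}\to\mathbb{R}$ a bounded, symmetric, positive semi-definite bilinear form that is coercive on $\ker\mathcal{T}$, $\mathcal{V}_h\subset\mathcal{V}$ a finite-dimensional subspace, $f\in\mathcal{V}^*$ and $g\in\mathcal{Q}$. Suppose that Assumptions 1 and 2 (stated in the context) hold. Then there exists a unique discrete solution $u_h\in\mathcal{V}_h$ to Problem $(N_h)$ (Nitsche's method). Moreover, if the solution $u\in\mathcal{V}$ to Problem $(M)$ satisfies $u\in\tilde{\mathcal{V}}$, then $$|||u-u_h|||\le\left(1+\frac{2}{1-\frac1\gamma}\right)\min_{v_h\in\mathcal{V}_h}|||u-v_h|||.$$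
   Context: Setting. $\mathcal{V}^*,\mathcal{Q}^*$ are the dual spaces with duality pairings ${}_{\mathcal{V}^*}\langle\cdot,\cdot\rangle_{\mathcal{V}}$, ${}_{\mathcal{Q}^*}\langle\cdot,\cdot\rangle_{\mathcal{Q}}$. For $g\in\mathcal{Q}$, $\mathcal{V}_g:=\{v\in\mathcal{V}:\mathcal{T}v=g\}$. Coercivity on $\ker\mathcal{T}$ means: there is $C>0$ with $a(v,v)\ge C\|v\|_{\mathcal{V}}^2$ for all $v\in\mathcal{V}_0$. Problem $(M)$: find $u\in\mathcal{V}_g$ minimizing $\frac12a(u,u)-{}_{\mathcal{V}^*}\langle f,u\rangle_{\mathcal{V}}$ over $\mathcal{V}_g$ (equivalently, $a(u,\delta u)={}_{\mathcal{V}^*}\langle f,\delta u\rangle_{\mathcal{V}}$ for all $\delta u\in\mathcal{V}_0$). Assumption 1: there exist a dense subspace $\tilde{\mathcal{V}}\subset\mathcal{V}$ and linear maps $\mathcal{L}:\tilde{\mathcal{V}}\to\mathcal{V}^*$, $\mathcal{B}:\tilde{\mathcal{V}}\to\mathcal{Q}^*$ such that $a(w,v)={}_{\mathcal{V}^*}\langle\mathcal{L}w,v\rangle_{\mathcal{V}}+{}_{\mathcal{Q}^*}\langle\mathcal{B}w,\mathcal{T}v\rangle_{\mathcal{Q}}$ for all $w\in\tilde{\mathcal{V}}$, $v\in\mathcal{V}$, and the solution $u$ of Problem $(M)$ satisfies $\mathcal{L}u=f$ whenever $f\in\mathcal{V}^*$ and $g\in\mathcal{Q}$ are such that $u\in\tilde{\mathcal{V}}$.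 The map $\epsilon:\mathrm{dom}(\epsilon)\subseteq\mathcal{Q}^*\to\mathcal{Q}$ is a densely defined, positive, surjective, self-adjoint linear map (self-adjoint: ${}_{\mathcal{Q}^*}\langle\xi,\epsilon\mu\rangle_{\mathcal{Q}}={}_{\mathcal{Q}^*}\langle\mu,\epsilon\xi\rangle_{\mathcal{Q}}$; positive: ${}_{\mathcal{Q}^*}\langle\mu,\epsilon\mu\rangle_{\mathcal{Q}}>0$ for $\mu\ne0$); hence it is invertible. It is assumed that $\mathcal{B}$ has been extended linearly to $\tilde{\mathcal{V}}+\mathcal{V}_h$ and that $\{\mathcal{B}v:v\in\tilde{\mathcal{V}}+\mathcal{V}_h\}\subset\mathrm{dom}(\epsilon)$. The bilinear form $a_h$ on $(\tilde{\mathcal{V}}+\mathcal{V}_h)\times(\tilde{\mathcal{V}}+\mathcal{V}_h)$ is $$a_h(w,v)=a(w,v)-{}_{\mathcal{Q}^*}\langle\mathcal{B}w,\mathcal{T}v\rangle_{\mathcal{Q}}-{}_{\mathcal{Q}^*}\langle\mathcal{B}v,\mathcal{T}w\rangle_{\mathcal{Q}}+{}_{\mathcal{Q}^*}\langle\epsilon^{-1}\mathcal{T}v,\mathcal{T}w\rangle_{\mathcal{Q}}.$$ Problem $(N_h)$: find $u_h\in\mathcal{V}_h$ such that, for all $\delta u_h\in\mathcal{V}_h$, $$a_h(u_h,\delta u_h)={}_{\mathcal{V}^*}\langle f,\delta u_h\rangle_{\mathcal{V}}-{}_{\mathcal{Q}^*}\langle\mathcal{B}\delta u_h,g\rangle_{\mathcal{Q}}+{}_{\mathcal{Q}^*}\langle\epsilon^{-1}\mathcal{T}\delta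 u_h,g\rangle_{\mathcal{Q}}.$$ Assumption 2: there exists a densely defined, positive, self-adjoint linear map $\eta:\mathrm{dom}(\eta)\subseteq\mathcal{Q}^*\to\mathcal{Q}$ such that (1) $\{\mathcal{B}v:v\in\tilde{\mathcal{V}}+\mathcal{V}_h\}\subset\mathrm{dom}(\eta)$; (2) ${}_{\mathcal{Q}^*}\langle\mathcal{B}v_h,\eta\mathcal{B}v_h\rangle_{\mathcal{Q}}\le a(v_h,v_h)$ for all $v_h\in\mathcal{V}_h$; (3) for some $\gamma\in(1,\infty)$, $$\left|{}_{\mathcal{Q}^*}\langle\mathcal{B}v,\mathcal{T}w\rangle_{\mathcal{Q}}\right|\le\frac1\gamma\,{}_{\mathcal{Q}^*}\langle\mathcal{B}v,\eta\mathcal{B}v\rangle_{\mathcal{Q}}^{1/2}\,{}_{\mathcal{Q}^*}\langle\epsilon^{-1}\mathcal{T}w,\mathcal{T}w\rangle_{\mathcal{Q}}^{1/2}\quad\text{for all }v,w\in\tilde{\mathcal{V}}+\mathcal{V}_h.$$ The energy norm on $\tilde{\mathcal{V}}+\mathcal{V}_h$ is $|||v|||^2:=a(v,v)+{}_{\mathcal{Q}^*}\langle\mathcal{B}v,\eta\mathcal{B}v\rangle_{\mathcal{Q}}+2\,{}_{\mathcal{Q}^*}\langle\epsilon^{-1}\mathcal{T}v,\mathcal{T}v\rangle_{\mathcal{Q}}$. *)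

(* Defs.v *)
From HB Require Import structures.
From mathcomp Require Import all_boot all_order all_algebra.
From mathcomp Require Import all_classical all_reals all_analysis.

Set Implicit Arguments.
Unset Strict Implicit.
Unset Printing Implicit Defensive.

Import Order.TTheory GRing.Theory Num.Theory.
Import numFieldNormedType.Exports.

Local Open Scope classical_set_scope.
Local Open Scope ring_scope.

HB.mixin Record CompleteNormedModule_isHilbert (R : realType) V
    & CompleteNormedModule R V := {
  inner : V -> V -> R ;
  innerC : forall u v : V, inner u v = inner v u ;
  inner_linearl : forall (c : R) (u v w : V),
    inner (c *: u + v) w = c * inner u w + inner v w ;
  inner_norm : forall v : V, inner v v = `|v| ^+ 2
}.

#[short(type="hilbertType")]
HB.structure Definition Hilbert (R : realType) :=
  {V of CompleteNormedModule_isHilbert R V & CompleteNormedModule R V}.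

Section Dual.
Variables (R : realType) (V : normedModType R).

Definition dual_pred : {pred V -> R^o} := fun f : V -> R^o =>
  `[< linear f /\ continuous f >].

Lemma dual_pred_closed : submod_closed dual_pred.
Proof.
split.
  apply/asboolP; split; last by move=> x; exact: cvg_cst.
  by move=> c x y; rewrite -[RHS]/(c *: (0 : R^o) + 0) scaler0 addr0.
move=> c f g /asboolP[lf cf] /asboolP[lg cg]; apply/asboolP; split.
  move=> k x y; rewrite -[LHS]/(c *: f (k *: x + y) + g (k *: x + y)) lf lg.
  rewrite -[RHS]/(k *: (c *: f x + g x) + (c *: f y + g y)).
  by rewrite !scalerDr !scalerA (mulrC c) addrACA.
move=> x; apply: cvgD; last exact: cg.
by apply: cvgZr; exact: cf.
Qed.

HB.instance Definition _ := GRing.isSubmodClosed.Build R (V -> R^o) dual_pred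
  (GRing.submod_closed_semi dual_pred_closed).

(* The topological dual; the pairing <f, x> is the application f x. *)
Record dual := Dual { dual_fun :> V -> R^o ; _ : dual_fun \in dual_pred }.

HB.instance Definition _ := [isSub for dual_fun].
HB.instance Definition _ := [Choice of dual by <:].
HB.instance Definition _ := [SubChoice_isSubLmodule of dual by <:].

Lemma dual_linear (f : dual) : linear (f : V -> R^o).
Proof. by case: f => f /= /asboolP[]. Qed.

Lemma dual_continuous (f : dual) : continuous (f : V -> R^o).
Proof. by case: f => f /= /asboolP[]. Qed.

Lemma dualD (f g : dual) x : (f + g) x = f x + g x.
Proof. by []. Qed.

Lemma dualZ (c : R) (f : dual) x : (c *: f) x = c * f x.
Proof. by []. Qed.

Implicit Types f g : dual.

Definition dual_norm (f : dual) : R :=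
  sup [set `|f x| | x in [set x : V | `|x| <= 1]].

Lemma dual_linear0 (f : dual) : f 0 = 0.
Proof.
by have := dual_linear f (-1) 0 0; rewrite scaleN1r addNr scaleN1r addNr.
Qed.

Lemma dual_linearZ (f : dual) c x : f (c *: x) = c * f x.
Proof.
by have := dual_linear f c x 0; rewrite !addr0 dual_linear0 addr0.
Qed.

Lemma dual_has_sup (f : dual) :
  has_sup [set `|f x| | x in [set x : V | `|x| <= 1]].
Proof.
split; first by exists `|f 0|, 0 => //=; rewrite normr0.
have [d /= d0 df] : exists2 d : R, 0 < d & forall x, `|x| < d -> `|f x| < 1.
  have /(cvgrPdist_lt (f : V -> R^o)) /(_ 1 ltr01) := @dual_continuous f 0.
  rewrite -nbhs_nearE => /nbhs_norm0P[d d0 dP]; exists d => // x xd.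
  by have := dP x xd; rewrite /= dual_linear0 sub0r normrN.
exists (2 / d) => _ [x /= x1 <-].
have d2 : 0 < d / 2 by rewrite divr_gt0.
have xd : `|(d / 2) *: x| < d.
  rewrite normrZ gtr0_norm// (@le_lt_trans _ _ (d / 2))//.
    by rewrite ler_piMr// ltW.
  by rewrite gtr_pMr// invf_lt1// ltr1n.
have := df _ xd; rewrite dual_linearZ normrM (gtr0_norm d2).
by rewrite -ltr_pdivlMl// mulr1 invf_div => /ltW.
Qed.

Lemma dual_norm_ub (f : dual) x : `|x| <= 1 -> `|f x| <= dual_norm f.
Proof. by move=> x1; apply: ub_le_sup; [exact: (dual_has_sup f).2|exists x]. Qed.

Lemma dual_norm_lub (f : dual) M :
  (forall x, `|x| <= 1 -> `|f x| <= M) -> dual_norm f <= M.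
Proof.
move=> fM; apply: ge_sup; first exact: (dual_has_sup f).1.
by move=> _ [x x1 <-]; exact: fM.
Qed.

Lemma dual_normD f g : dual_norm (f + g) <= dual_norm f + dual_norm g.
Proof.
apply: dual_norm_lub => x x1; rewrite dualD (le_trans (ler_normD _ _))//.
by rewrite lerD// dual_norm_ub.
Qed.

Lemma dual_norm0 : dual_norm 0 = 0.
Proof.
apply/eqP; rewrite eq_le; apply/andP; split.
  by apply: dual_norm_lub => x _; rewrite normr0.
by apply: le_trans (@dual_norm_ub 0 0 _); rewrite ?normr0.
Qed.

Lemma dual_normZ (c : R) f : dual_norm (c *: f) = `|c| * dual_norm f.
Proof.
have le k g : dual_norm (k *: g) <= `|k| * dual_norm g.
  apply: dual_norm_lub => x x1; rewrite dualZ normrM ler_wpM2l//.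
  exact: dual_norm_ub.
apply/eqP; rewrite eq_le le/=.
have [->|c0] := eqVneq c 0; first by rewrite normr0 mul0r scale0r dual_norm0.
rewrite -ler_pdivlMl ?normr_gt0// -normfV.
by rewrite -{1}[f](scalerK c0) le.
Qed.

Lemma dual_norm_eq0 f : dual_norm f = 0 -> f = 0.
Proof.
move=> f0; apply/val_inj/funext => x /=; apply/eqP; rewrite -normr_le0.
have [->|x0] := eqVneq x 0; first by rewrite dual_linear0 normr0.
have nx : 0 < `|x| by rewrite normr_gt0.
have := @dual_norm_ub f (`|x|^-1 *: x).
rewrite f0 dual_linearZ normrZ normrM normfV normr_id mulVf ?gt_eqF//.
by move=> /(_ (lexx _)); rewrite pmulr_rle0 ?invr_gt0.
Qed.

HB.instance Definition _ :=
  Lmodule_isNormed.Build R dual dual_normD dual_normZ dual_norm_eq0.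

End Dual.

(* An operator defined on a subspace D of E is a total function of which only *)
(* the values on D are used.                                                  *)
Section PartialOperators.
Variables (R : realType).

Definition linear_on (E F : lmodType R) (D : {pred E}) (f : E -> F) :=
  forall c : R, {in D &, forall x y, f (c *: x + y) = c *: f x + f y}.

Definition add_subspace (E : lmodType R) (D1 D2 : {pred E}) : {pred E} :=
  fun w => `[< exists x y, [/\ x \in D1, y \in D2 & w = x + y] >].

Definition finite_dim (E : lmodType R) (D : {pred E}) :=
  exists (n : nat) (e : 'I_n -> E), forall v,
    v \in D <-> exists c : 'I_n -> R, v = \sum_i c i *: e i.

Variable Q : hilbertType R.
Implicit Types (D : submodClosed (dual Q)) (op : dual Q -> Q).

Definition densely_defined D := dense [set` D].

Definition positive_on D op :=
  {in D, forall mu : dual Q, mu != 0 -> 0 < mu (op mu)}.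

(* Symmetry with respect to the duality pairing; no maximality of the domain  *)
(* is required.                                                               *)
Definition self_adjoint_on D op :=
  {in D &, forall mu xi : dual Q, xi (op mu) = mu (op xi)}.

Definition surjective_on D op := set_surj [set` D] setT op.

(* The inverse Q -> D of an operator that is a bijection from D onto Q.       *)
Definition op_inv D op : Q -> dual Q := 'pinv_(fun=> 0) [set` D] op.

End PartialOperators.

Section Nitsche.
Variables (R : realType) (V Q : hilbertType R).
Variables (T : {linear V -> Q}) (a : {bilinear V -> V -> R | *%R & *%R}).

Definition map_bounded := exists C : R, forall v, `|T v| <= C * `|v|.

Definition form_bounded := exists C : R, forall u v, `|a u v| <= C * `|u| * `|v|.

Definition form_sym := forall u v, a u v = a v u.

Definition form_psd := forall v, 0 <= a v v.

Definition coercive_on_ker :=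
  exists2 C : R, 0 < C & forall v, T v = 0 -> C * `|v| ^+ 2 <= a v v.

Definition potential (f : dual V) (v : V) : R := 2^-1 * a v v - f v.

Definition constrained_min (f : dual V) (g : Q) (u : V) :=
  T u = g /\ forall v, T v = g -> potential f u <= potential f v.

Definition green_identity (Vt : {pred V}) (L : V -> dual V) (B : V -> dual Q) :=
  {in Vt, forall w v, a w v = L w v + B w (T v)}.

(* This concerns the data f and g of the problem at hand. Requiring it for    *)
(* all f and g would force Q = 0: for xi in the dual of Q, u = 0 solves the   *)
(* problem with f = xi \o T and g = 0, whence xi \o T = L 0 = 0.              *)
Definition euler_lagrange (Vt : {pred V}) (L : V -> dual V) (f : dual V) (g : Q) :=
  forall u, constrained_min f g u -> u \in Vt -> L u = f.

Variables (B : V -> dual Q) (epsV : Q -> dual Q).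

Definition nitsche_form (w v : V) : R :=
  a w v - B w (T v) - B v (T w) + epsV (T v) (T w).

Definition nitsche_solution (Vh : {pred V}) (f : dual V) (g : Q) (uh : V) :=
  uh \in Vh /\ {in Vh, forall v,
    nitsche_form uh v = f v - B v g + epsV (T v) g}.

Variable eta : dual Q -> Q.

Definition energy_norm (v : V) : R :=
  Num.sqrt (a v v + B v (eta (B v)) + 2 * epsV (T v) (T v)).

Definition inverse_estimate (Vh : {pred V}) :=
  {in Vh, forall v, B v (eta (B v)) <= a v v}.

Definition generalized_cauchy_schwarz (W : {pred V}) (gamma : R) :=
  {in W &, forall v w, `|B v (T w)| <=
    gamma^-1 * Num.sqrt (B v (eta (B v))) * Num.sqrt (epsV (T w) (T w))}.

End Nitsche.

(* Main.v *)
(* The squared energy norm is the quadratic form of a symmetric bilinear form *)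
(* on W = Vt + Vh, definite because a is coercive on ker T. By Cauchy-Schwarz *)
(* for a and eps^-1 and the generalized one for B, a_h is bounded on W with   *)
(* constant 1 in this norm. On Vh the inverse estimate makes it coercive with *)
(* constant (1 - 1/gamma)/2, half being lost since the squared norm is at     *)
(* most 2 (a(v,v) + <eps^-1 T v, T v>). Hence a_h is definite on the          *)
(* finite-dimensional Vh, and Green's identity with L u = f gives             *)
(* a_h(u - uh, v) = 0 for v in Vh, so that Cea's argument applies.            *)

Require Import Defs.
From HB Require Import structures.
From mathcomp Require Import all_boot all_order all_algebra.
From mathcomp Require Import all_classical all_reals all_analysis.
From mathcomp Require Import ring lra.

Set Implicit Arguments.
Unset Strict Implicit.
Unset Printing Implicit Defensive.

Import Order.TTheory GRing.Theory Num.Theory.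
Import numFieldNormedType.Exports.

Local Open Scope classical_set_scope.
Local Open Scope ring_scope.

(** All that remains after two estimates is linear algebra of symmetric forms on a subspace. With c
    = (1 - 1/gamma) / 2, [nitsche_form_bounded] bounds a_h by 1 on W and [nitsche_form_coercive]
    bounds it below by c on [Vh], both in the norm of [energy_form]. Then [lax_milgram_on] gives the
    discrete solution, [best_approximation_on] shows that the minimum over [Vh] is attained, and
    [cea_on] gives the factor 1 + 1/c = 1 + 2 / (1 - 1/gamma). *)

(** * Subspaces and maps linear on a subspace *)

Lemma add_subspace_closed (R : realType) (E : lmodType R)
  (D1 D2 : submodClosed E) : submod_closed (add_subspace D1 D2).
Proof.
split; first by apply/asboolP; exists 0, 0; rewrite !rpred0 addr0.
move=> c _ _ /asboolP[x [y [xD yD ->]]] /asboolP[x' [y' [x'D y'D ->]]].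
apply/asboolP; exists (c *: x + x'), (c *: y + y').
by rewrite !rpredD ?rpredZ// scalerDr addrACA.
Qed.

HB.instance Definition _ (R : realType) (E : lmodType R)
    (D1 D2 : submodClosed E) :=
  GRing.isSubmodClosed.Build R E (add_subspace D1 D2)
    (GRing.submod_closed_semi (add_subspace_closed D1 D2)).

Lemma add_subspacel (R : realType) (E : lmodType R) (D1 D2 : submodClosed E) :
  {subset D1 <= add_subspace D1 D2}.
Proof. by move=> x xD; apply/asboolP; exists x, 0; rewrite rpred0 addr0. Qed.

Lemma add_subspacer (R : realType) (E : lmodType R) (D1 D2 : submodClosed E) :
  {subset D2 <= add_subspace D1 D2}.
Proof. by move=> x xD; apply/asboolP; exists 0, x; rewrite rpred0 add0r. Qed.

(* [submodClosed] is defined over semimodules, so [rpredB] does not apply. *)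
Lemma rpredB_submod (R : realType) (E : lmodType R) (D : submodClosed E) :
  {in D &, forall x y, x - y \in D}.
Proof. exact: (GRing.submod_closedB (GRing.submodClosedP D)).2. Qed.

Section LinearOn.
Variables (R : realType) (E F : lmodType R) (D : submodClosed E) (f : E -> F).
Hypothesis lf : linear_on D f.

Lemma linear_on0 : f 0 = 0.
Proof.
by have := lf (-1) (rpred0 D) (rpred0 D); rewrite !scaleN1r oppr0 addr0 addNr.
Qed.

Lemma linear_onD : {in D &, {morph f : x y / x + y}}.
Proof. by move=> x y xD yD; have := lf 1 xD yD; rewrite !scale1r. Qed.

Lemma linear_onZ c : {in D, {morph f : x / c *: x}}.
Proof.
by move=> x xD; have := lf c xD (rpred0 D); rewrite linear_on0 !addr0.
Qed.

Lemma linear_onB : {in D &, {morph f : x y / x - y}}.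
Proof.
move=> x y xD yD; have := lf (-1) yD xD.
by rewrite !scaleN1r addrC => ->; rewrite addrC.
Qed.

Lemma linear_on_sum n (c : 'I_n -> R) (e : 'I_n -> E) :
  (forall i, e i \in D) -> f (\sum_i c i *: e i) = \sum_i c i *: f (e i).
Proof.
move=> eD.
suff [] : (\sum_i c i *: e i \in D) /\
  f (\sum_i c i *: e i) = \sum_i c i *: f (e i) by [].
apply: (big_ind2 (fun x y => x \in D /\ f x = y)).
- by rewrite rpred0 linear_on0.
- by move=> x _ y _ [xD <-] [yD <-]; rewrite rpredD// linear_onD.
- by move=> i _; rewrite rpredZ// linear_onZ.
Qed.

End LinearOn.

(** For scalar values the scaling of [R^o] is the product of [R]; this form exposes the product to
    rewriting. *)
Lemma linear_form_on_sum (R : realType) (E : lmodType R) (D : submodClosed E)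
    (l : E -> R) (ll : linear_on D (l : E -> R^o))
    n (c : 'I_n -> R) (e : 'I_n -> E) :
  (forall i, e i \in D) -> l (\sum_i c i *: e i) = \sum_i c i * l (e i).
Proof. exact: (linear_on_sum ll). Qed.

(** * Symmetric forms on a subspace: Cauchy-Schwarz, Lax-Milgram, projection, Cea *)

Section SymmetricForms.
Variables (R : realType) (E : lmodType R).
Implicit Types (D : submodClosed E) (s : E -> E -> R).

(** Symmetry carries linearity over to the first argument. Everything is relative to a subspace
    because [B] and [eta] are linear only on their domains. *)
Definition symmetric_form_on (D : {pred E}) s :=
  {in D &, forall x y, s x y = s y x} /\
  {in D, forall z, linear_on D (s z : E -> R^o)}.

Lemma symmetric_form_onW (D D' : {pred E}) s : {subset D' <= D} ->
  symmetric_form_on D s -> symmetric_form_on D' s.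
Proof.
move=> DD' [sC sl]; split; first by move=> x y /DD' xD /DD' yD; exact: sC.
by move=> z /DD' zD c x y /DD' xD /DD' yD; exact: sl.
Qed.

Lemma symmetric_form_on_sqrD D s c : symmetric_form_on D s ->
  {in D &, forall x y,
    s (x + c *: y) (x + c *: y) = s y y * c ^+ 2 + 2 * s x y * c + s x x}.
Proof.
move=> [sC sl] x y xD yD.
have cyD : c *: y \in D by rewrite rpredZ.
have xyD : x + c *: y \in D by rewrite rpredD.
rewrite (linear_onD (sl _ xyD))// (linear_onZ (sl _ xyD))//.
rewrite !(sC (x + _))// !(linear_onD (sl _ xD))// !(linear_onD (sl _ yD))//.
rewrite !(linear_onZ (sl _ xD))// !(linear_onZ (sl _ yD))// (sC y x)//.
rewrite /GRing.scale/=; ring.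
Qed.

(** The polynomial c -> s (x + c y) (x + c y) is nonnegative, so its discriminant is at most 0. This
    includes the degenerate case s y y = 0. *)
Lemma cauchy_schwarz_on D s : symmetric_form_on D s ->
  {in D, forall x, 0 <= s x x} ->
  {in D &, forall x y, `|s x y| <= Num.sqrt (s x x) * Num.sqrt (s y y)}.
Proof.
move=> sf s0 x y xD yD.
rewrite -sqrtrM ?s0// -sqrtr_sqr ler_wsqrtr//.
have := deg_le2_poly_ge0 (size_Poly [:: s x x; 2 * s x y; s y y]).
rewrite !coef_Poly => d0.
have {d0} : (2 * s x y) ^+ 2 - 4 * s y y * s x x <= 0.
  apply: d0 => c; rewrite horner_Poly/= mul0r add0r.
  have -> : (s y y * c + 2 * s x y) * c + s x x =
            s y y * c ^+ 2 + 2 * s x y * c + s x x by ring.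
  by rewrite -(symmetric_form_on_sqrD c sf)// s0// rpredD ?rpredZ.
by rewrite exprMn; lra.
Qed.

Lemma minkowski_on D s : symmetric_form_on D s ->
  {in D, forall x, 0 <= s x x} ->
  {in D &, forall x y,
    Num.sqrt (s (x + y) (x + y)) <= Num.sqrt (s x x) + Num.sqrt (s y y)}.
Proof.
move=> sf s0 x y xD yD.
rewrite -[leRHS]ger0_norm ?addr_ge0 ?sqrtr_ge0// -sqrtr_sqr.
rewrite ler_wsqrtr// -[y in leLHS]scale1r (symmetric_form_on_sqrD 1 sf)//.
have := cauchy_schwarz_on sf s0 xD yD.
rewrite sqrrD !sqr_sqrtr ?s0// => /(le_trans (ler_norm _)).
by rewrite -[_ *+ 2]mulr_natl; lra.
Qed.

(** The family [e] spans [D] but may be dependent, so the Gram matrix [G] may be singular. Existence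
    therefore means that [b] lies in the row space of [G]; uniqueness follows from definiteness
    applied to the difference of two solutions. *)
Lemma lax_milgram_on D s (l : E -> R) : finite_dim D -> symmetric_form_on D s ->
  {in D, forall x, x != 0 -> 0 < s x x} -> linear_on D (l : E -> R^o) ->
  exists! x, x \in D /\ {in D, forall y, s x y = l y}.
Proof.
move=> [n [e De]] [sC sl] s_gt0 ll.
have eD i : e i \in D.
  apply/De; exists (fun j => (i == j)%:R).
  rewrite (bigD1 i)//= eqxx scale1r big1 ?addr0// => j ji.
  by rewrite eq_sym (negbTE ji) scale0r.
have sumD c : \sum_i c i *: e i \in D by apply/De; exists c.
pose G := \matrix_(i, j) s (e i) (e j).
pose b := \row_j l (e j).
have /submxP[c bE] : (b <= G)%MS.
  (* The kernel of the Gram matrix maps to 0 in E, since s is definite there, *)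
  (* so b, which factors through E, annihilates it: no basis is needed.       *)
  rewrite submxE; apply/eqP/matrixP => i k; rewrite ord1 [RHS]mxE.
  pose K := cokermx G; pose x := \sum_j K j k *: e j.
  have sx j : s (e j) x = 0.
    rewrite (linear_form_on_sum (sl _ (eD j)))//.
    have /matrixP/(_ j k) := mulmx_coker G; rewrite [LHS]mxE [RHS]mxE => GK.
    rewrite -[RHS]GK.
    by apply: eq_bigr => m _; rewrite [G _ _]mxE mulrC.
  have x0 : x = 0.
    have [//|/(s_gt0 _ (sumD _))] := eqVneq x 0; rewrite -/x.
    rewrite {2}/x (linear_form_on_sum (sl _ (sumD _)))// big1 ?ltxx// => j _.
    by rewrite -/x sC ?sumD// sx mulr0.
  have : l x = 0 by rewrite x0 (linear_on0 ll).
  rewrite (linear_form_on_sum ll)// => lx; rewrite mxE -[RHS]lx.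
  by apply: eq_bigr => m _; rewrite [b _ _]mxE mulrC.
pose x := \sum_i c 0 i *: e i.
have xD : x \in D by exact: sumD.
have sx : {in D, forall y, s x y = l y}.
  move=> _ /De[d ->].
  rewrite (linear_form_on_sum (sl _ xD))// (linear_form_on_sum ll)//.
  apply: eq_bigr => j _; congr (_ * _).
  rewrite sC// (linear_form_on_sum (sl _ (eD j)))//.
  have /matrixP/(_ 0 j) := bE; rewrite !mxE => ->.
  by apply: eq_bigr => i _; rewrite mxE sC.
exists x; split=> // y [yD sy].
have xyD : x - y \in D by rewrite rpredB_submod.
have [/subr0_eq//|/(s_gt0 _ xyD)] := eqVneq (x - y) 0.
rewrite (linear_onB (sl _ xyD))// !(sC (x - y))//.
rewrite !(linear_onB (sl _ xD))// !(linear_onB (sl _ yD))//.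
by rewrite !sx// !sy// subrr ltxx.
Qed.

(** The minimizer is the orthogonal projection of [u], obtained from [lax_milgram_on] with
    right-hand side [s u]; Pythagoras gives minimality. *)
Lemma best_approximation_on D D' s u : {subset D' <= D} -> u \in D ->
  finite_dim D' -> symmetric_form_on D s ->
  {in D, forall x, x != 0 -> 0 < s x x} ->
  exists v0, v0 \in D' /\
    {in D', forall v, s (u - v0) (u - v0) <= s (u - v) (u - v)}.
Proof.
move=> D'D uD fD' sf s_gt0.
have s_ge0 : {in D, forall x, 0 <= s x x}.
  move=> x xD; have [->|x0] := eqVneq x 0; last by rewrite ltW ?s_gt0.
  by have [_ sl] := sf; rewrite (linear_on0 (sl _ (rpred0 D))).
have [v0 [[v0D' sv0] _]] := lax_milgram_on fD' (symmetric_form_onW D'D sf)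
  (fun x xD' => s_gt0 x (D'D x xD'))
  (fun c x y xD' yD' => (sf.2 _ uD) c x y (D'D x xD') (D'D y yD')).
exists v0; split=> // v vD'.
have v0D := D'D _ v0D'; have vD := D'D _ vD'.
have uv0D : u - v0 \in D by rewrite rpredB_submod.
have v0vD' : v0 - v \in D' by rewrite rpredB_submod.
have v0vD := D'D _ v0vD'.
have -> : u - v = u - v0 + 1 *: (v0 - v) by rewrite scale1r addrA subrK.
rewrite (symmetric_form_on_sqrD 1 sf)//.
have -> : s (u - v0) (v0 - v) = 0.
  rewrite sf.1// (linear_onB (sf.2 _ v0vD))// ![s (v0 - v) _]sf.1//.
  by rewrite sv0// subrr.
by rewrite mulr0 mul0r addr0 expr1n mulr1 lerDr s_ge0.
Qed.

(** Split u - uh at [v] by the triangle inequality. In the norm of [n], coercivity, Galerkin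
    orthogonality and boundedness give c |v - uh|^2 <= s (v - uh) (v - uh) = - s (u - v) (v - uh) <=
    |u - v| |v - uh|. *)
Lemma cea_on D D' n s c u uh : {subset D' <= D} -> u \in D -> uh \in D' ->
  symmetric_form_on D n -> {in D, forall x, 0 <= n x x} ->
  symmetric_form_on D s ->
  {in D &, forall x y, `|s x y| <= Num.sqrt (n x x) * Num.sqrt (n y y)} ->
  0 < c -> {in D', forall x, c * n x x <= s x x} ->
  {in D', forall x, s u x = s uh x} ->
  {in D', forall v, Num.sqrt (n (u - uh) (u - uh)) <=
    (1 + c^-1) * Num.sqrt (n (u - v) (u - v))}.
Proof.
move=> D'D uD uhD' nf n0 sf sn c0 cs su v vD'.
have uhD := D'D _ uhD'; have vD := D'D _ vD'.
have uvD : u - v \in D by rewrite rpredB_submod.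
have vuhD' : v - uh \in D' by rewrite rpredB_submod.
have vuhD := D'D _ vuhD'.
have -> : u - uh = (u - v) + (v - uh) by rewrite addrA subrK.
apply: le_trans (minkowski_on nf n0 uvD vuhD) _.
rewrite mulrDl mul1r lerD2l mulrC ler_pdivlMr// mulrC.
set N := Num.sqrt (n (v - uh) (v - uh)).
(* A factor [N] is cancelled below, so the case N = 0 is settled apart. *)
have [->|N_neq0] := eqVneq N 0; first by rewrite mulr0 sqrtr_ge0.
have N_gt0 : 0 < N by rewrite lt_neqAle eq_sym N_neq0 sqrtr_ge0.
rewrite -(ler_pM2r N_gt0); apply: le_trans (sn _ _ uvD vuhD).
(* Galerkin orthogonality: u - uh is [s]-orthogonal to v - uh, which lies in [D']. *)
have -> : s (u - v) (v - uh) = - s (v - uh) (v - uh).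
  rewrite sf.1// [in RHS](linear_onB (sf.2 _ vuhD))//.
  rewrite (linear_onB (sf.2 _ vuhD))//.
  by rewrite opprB ![s (v - uh) _]sf.1// su.
rewrite normrN -mulrA -expr2 sqr_sqrtr ?n0//.
by apply: le_trans (cs _ vuhD') _; exact: ler_norm.
Qed.

End SymmetricForms.

(** * Positive operators and their inverses *)

Section PositiveOperators.
Variables (R : realType) (Q : hilbertType R).
Variables (D : submodClosed (dual Q)) (op : dual Q -> Q).
Hypotheses (lop : linear_on D op) (op_gt0 : positive_on D op).

Lemma positive_on_inj : {in D &, injective op}.
Proof.
move=> x y xD yD oxy; apply/eqP; rewrite -subr_eq0; apply: contraT => xy0.
have := op_gt0 (rpredB_submod xD yD) xy0.
by rewrite (linear_onB lop)// oxy subrr dual_linear0 ltxx.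
Qed.

Lemma positive_on_ge0 : {in D, forall mu : dual Q, 0 <= mu (op mu)}.
Proof.
by move=> mu muD; have [->//|mu0] := eqVneq mu 0; rewrite ltW ?op_gt0.
Qed.

Hypothesis op_surj : surjective_on D op.

(** Surjectivity supplies a preimage in [D] and positivity makes [op] injective there, so the
    default value of the partial inverse is never taken. *)
Lemma op_invP q : op_inv D op q \in D /\ op (op_inv D op q) = q.
Proof.
have [mu /= muD <-] := op_surj (I : setT q).
have D_inj : {in [set` D] &, injective op}.
  by move=> x y; rewrite !inE; exact: positive_on_inj.
by rewrite /op_inv pinvKV ?inE.
Qed.

Lemma op_inv_linear : linear (op_inv D op).
Proof.
move=> c q r; have [qD opq] := op_invP q; have [rD opr] := op_invP r.
have [qrD opqr] := op_invP (c *: q + r).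
apply: positive_on_inj; rewrite ?rpredD ?rpredZ//.
by rewrite lop// opq opr.
Qed.

Lemma op_inv_gt0 q : q != 0 -> 0 < op_inv D op q q.
Proof.
move=> q0; have [qD opq] := op_invP q.
rewrite -{2}opq op_gt0//; apply: contra_neq q0 => q0.
by rewrite -opq q0 (linear_on0 lop).
Qed.

Lemma op_inv_sym : self_adjoint_on D op ->
  forall q r, op_inv D op q r = op_inv D op r q.
Proof.
move=> opC q r; have [qD opq] := op_invP q; have [rD opr] := op_invP r.
by rewrite -{1}opr opC// opq.
Qed.

End PositiveOperators.

(** * The energy form and the estimates for Nitsche's form *)

Section NitscheTheory.
Variables (R : realType) (V Q : hilbertType R).
Variables (T : {linear V -> Q}) (a : {bilinear V -> V -> R | *%R & *%R}).
Variables (W Vh : submodClosed V) (B : V -> dual Q).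
Variables (epsV : Q -> dual Q) (D : submodClosed (dual Q)) (eta : dual Q -> Q).

(** The polarization of the squared energy norm. *)
Definition energy_form (v w : V) : R :=
  a v w + B v (eta (B w)) + 2 * epsV (T v) (T w).

Hypotheses (aC : form_sym a) (a_ge0 : form_psd a) (a_co : coercive_on_ker T a).
Hypotheses (lB : linear_on W B) (BD : {in W, forall v, B v \in D}).
Hypotheses (leps : linear epsV) (epsC : forall q r, epsV q r = epsV r q)
  (eps_gt0 : forall q, q != 0 -> 0 < epsV q q).
Hypotheses (leta : linear_on D eta) (eta_gt0 : positive_on D eta)
  (etaC : self_adjoint_on D eta).

Let eps_ge0 q : 0 <= epsV q q.
Proof.
by have [->|q0] := eqVneq q 0; rewrite ?dual_linear0// ltW ?eps_gt0.
Qed.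

Let eta_ge0 v : v \in W -> 0 <= B v (eta (B v)).
Proof. by move=> vW; rewrite (positive_on_ge0 eta_gt0)// BD. Qed.

(** Off ker T the second term is positive; on ker T coercivity makes the first one positive. *)
Lemma form_def_ge0 (v : V) : v != 0 -> 0 < a v v + epsV (T v) (T v).
Proof.
move=> v0; have [Tv0|Tv0] := eqVneq (T v) 0; last by rewrite ltr_wpDl ?eps_gt0.
have [C C0 aC'] := a_co; rewrite ltr_pwDl// (lt_le_trans _ (aC' _ Tv0))//.
by rewrite mulr_gt0// exprn_gt0// normr_gt0.
Qed.

Lemma symmetric_form : symmetric_form_on W (a : V -> V -> R).
Proof.
by split=> [x y _ _|z _ c x y _ _]; [exact: aC|exact: linearPr].
Qed.

Lemma symmetric_eps_form :
  symmetric_form_on W (fun v w => epsV (T v) (T w)).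
Proof.
by split=> [x y _ _|z _ c x y _ _]; [exact: epsC|rewrite linearP dual_linear].
Qed.

Lemma symmetric_eta_form : symmetric_form_on W (fun v w => B v (eta (B w))).
Proof.
split=> [x y xW yW|z zW c x y xW yW]; first by rewrite etaC ?BD.
by rewrite lB// leta ?BD// dual_linear.
Qed.

Lemma energy_form_symmetric : symmetric_form_on W energy_form.
Proof.
split=> [x y xW yW|z zW c x y xW yW]; rewrite /energy_form.
  by rewrite aC (symmetric_eta_form.1)// epsC.
rewrite symmetric_form.2// symmetric_eta_form.2// symmetric_eps_form.2//.
by rewrite /GRing.scale/=; ring.
Qed.

Lemma energy_form_gt0 : {in W, forall v, v != 0 -> 0 < energy_form v v}.
Proof.
move=> v vW v0; have := form_def_ge0 v0; rewrite /energy_form.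
by have := eps_ge0 (T v); have := eta_ge0 vW; lra.
Qed.

Lemma energy_form_ge0 : {in W, forall v, 0 <= energy_form v v}.
Proof. by move=> v vW; rewrite /energy_form !addr_ge0 ?mulr_ge0 ?eta_ge0. Qed.

Lemma nitsche_form_symmetric : symmetric_form_on W (nitsche_form T a B epsV).
Proof.
split=> [x y xW yW|z zW c x y xW yW]; rewrite /nitsche_form.
  by rewrite aC epsC; ring.
rewrite linearPr lB// linearP leps !dual_linear.
by rewrite !dualD !dualZ /GRing.scale/=; ring.
Qed.

Variable gamma : R.
Hypotheses (gamma_gt1 : 1 < gamma)
  (gcs : generalized_cauchy_schwarz T B epsV eta W gamma).

(** The four terms of a_h are bounded by a scalar product in R^4. The weight 2 in the energy norm
    pays for two uses of the eps^-1 seminorm: against the [eta] seminorm in a mixed term, and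
    against itself. Only 1/gamma <= 1 enters. *)
Lemma nitsche_form_bounded : {in W &, forall x y,
  `|nitsche_form T a B epsV x y| <=
    Num.sqrt (energy_form x x) * Num.sqrt (energy_form y y)}.
Proof.
have gV : gamma^-1 <= 1 by rewrite invf_le1 ?(lt_trans ltr01)// ltW.
have cs v w : v \in W -> w \in W -> `|B v (T w)| <=
    Num.sqrt (B v (eta (B v))) * Num.sqrt (epsV (T w) (T w)).
  by move=> vW wW; apply: le_trans (gcs vW wW) _; rewrite -mulrA ler_piMl.
move=> x y xW yW.
have := cauchy_schwarz_on symmetric_form (fun v _ => a_ge0 v) xW yW.
have := cauchy_schwarz_on symmetric_eps_form (fun v _ => eps_ge0 (T v)) yW xW.
have := cs _ _ xW yW; have := cs _ _ yW xW.
rewrite /energy_form /nitsche_form.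
have e z : z \in W -> a z z + B z (eta (B z)) + 2 * epsV (T z) (T z) =
    Num.sqrt (a z z) ^+ 2 + Num.sqrt (B z (eta (B z))) ^+ 2 +
    2 * Num.sqrt (epsV (T z) (T z)) ^+ 2.
  by move=> zW; rewrite !sqr_sqrtr ?eta_ge0.
rewrite !e//.
have := sqrtr_ge0 (a x x); have := sqrtr_ge0 (a y y).
have := sqrtr_ge0 (B x (eta (B x))); have := sqrtr_ge0 (B y (eta (B y))).
have := sqrtr_ge0 (epsV (T x) (T x)); have := sqrtr_ge0 (epsV (T y) (T y)).
move: (Num.sqrt (a x x)) (Num.sqrt (a y y)) (Num.sqrt (B x (eta (B x))))
  (Num.sqrt (B y (eta (B y)))) (Num.sqrt (epsV (T x) (T x)))
  (Num.sqrt (epsV (T y) (T y))) => ax ay nx ny ex ey.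
move=> ey0 ex0 ny0 nx0 ay0 ax0 cyx cxy ce ca.
rewrite -sqrtrM ?addr_ge0 ?mulr_ge0 ?sqr_ge0//.
have X0 : 0 <= ax * ay + nx * ey + ny * ex + ey * ex.
  by rewrite !addr_ge0 ?mulr_ge0.
apply: (@le_trans _ _ (ax * ay + nx * ey + ny * ex + ey * ex)).
  apply: le_trans (ler_normD _ _) _; apply: lerD => //.
  apply: le_trans (ler_normB _ _) _; apply: lerD => //.
  by apply: le_trans (ler_normB _ _) _; apply: lerD.
rewrite -[leLHS]ger0_norm// -sqrtr_sqr ler_wsqrtr// -subr_ge0.
(* Lagrange's identity for (ax, nx, ex, ex) and (ay, ey, ny, ey). *)
have -> :
    (ax ^+ 2 + nx ^+ 2 + 2 * ex ^+ 2) * (ay ^+ 2 + ny ^+ 2 + 2 * ey ^+ 2)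
    - (ax * ay + nx * ey + ny * ex + ey * ex) ^+ 2 =
    (ax * ey - nx * ay) ^+ 2 + (ax * ny - ex * ay) ^+ 2 +
    (ax * ey - ex * ay) ^+ 2 + (nx * ny - ex * ey) ^+ 2 +
    (nx * ey - ex * ey) ^+ 2 + (ex * ey - ex * ny) ^+ 2 by ring.
by rewrite !addr_ge0 ?sqr_ge0.
Qed.

Hypotheses (VhW : {subset Vh <= W}) (inv_est : inverse_estimate a B eta Vh).

(** Write k = 1/gamma, A = a v v, and n, e for the [eta] and eps^-1 seminorms. Then a_h(v,v) >= A -
    2 k n e + e^2 >= (1 - k) (A + e^2) by Young and n^2 <= A, while the energy is at most 2 (A +
    e^2). *)
Lemma nitsche_form_coercive : {in Vh, forall v,
  (1 - gamma^-1) / 2 * energy_form v v <= nitsche_form T a B epsV v v}.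
Proof.
move=> v vVh; have vW := VhW vVh.
have gV : gamma^-1 < 1 by rewrite invf_lt1 ?(lt_trans ltr01).
have g0 : 0 < gamma^-1 by rewrite invr_gt0 (lt_trans ltr01).
have := inv_est vVh; have := le_trans (ler_norm _) (gcs vW vW).
rewrite /energy_form /nitsche_form.
move: (Num.sqrt (B v (eta (B v)))) (Num.sqrt (epsV (T v) (T v)))
  (sqr_sqrtr (eta_ge0 vW)) (sqr_sqrtr (eps_ge0 (T v))) => n e <- <-.
move: (B v (T v) : R) (a v v) gamma^-1 gV g0 => b A k k1 k0 bne nA.
have : k * n * e <= k / 2 * (n ^+ 2 + e ^+ 2).
  rewrite -mulrA -mulrA ler_pM2l//.
  by have := sqr_ge0 (n - e); lra.
have : (1 - k) * n ^+ 2 <= (1 - k) * A.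
  by apply: ler_wpM2l => //; rewrite subr_ge0 ltW.
nra.
Qed.

End NitscheTheory.

(** * Well-posedness and quasi-optimality of Nitsche's method *)

Theorem theorem2 (R : realType) (V Q : hilbertType R)
    (T : {linear V -> Q}) (a : {bilinear V -> V -> R | *%R & *%R})
    (Vh Vt : submodClosed V) (f : dual V) (g : Q)
    (L : V -> dual V) (B : V -> dual Q)
    (dom_eps dom_eta : submodClosed (dual Q)) (eps eta : dual Q -> Q)
    (gamma : R) :
  let W := add_subspace Vt Vh in
  let eps_inv := op_inv dom_eps eps in
  let norm := energy_norm T a B eps_inv eta in
  map_bounded T -> (forall q : Q, exists v : V, T v = q) ->
  form_bounded a -> form_sym a -> form_psd a -> coercive_on_ker T a ->
  finite_dim Vh ->
  dense [set` Vt] -> linear_on Vt L -> linear_on W B ->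
  green_identity T a Vt L B -> euler_lagrange T a Vt L f g ->
  linear_on dom_eps eps -> densely_defined dom_eps ->
  positive_on dom_eps eps -> surjective_on dom_eps eps ->
  self_adjoint_on dom_eps eps ->
  {in W, forall v, B v \in dom_eps} ->
  linear_on dom_eta eta -> densely_defined dom_eta ->
  positive_on dom_eta eta -> self_adjoint_on dom_eta eta ->
  {in W, forall v, B v \in dom_eta} ->
  inverse_estimate a B eta Vh ->
  1 < gamma -> generalized_cauchy_schwarz T B eps_inv eta W gamma ->
  (exists! uh : V, nitsche_solution T a B eps_inv Vh f g uh) /\
  (forall u uh : V, constrained_min T a f g u -> u \in Vt ->
    nitsche_solution T a B eps_inv Vh f g uh ->
    exists v0 : V, [/\ v0 \in Vh,
      {in Vh, forall vh, norm (u - v0) <= norm (u - vh)} &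
      norm (u - uh) <= (1 + 2 / (1 - 1 / gamma)) * norm (u - v0)]).
Proof.
move=> W eps_inv norm _ _ _ aC a_ge0 a_co fVh _ _ lB green EL leps _ eps_gt0
  eps_surj epsC _ leta _ eta_gt0 etaC BD inv_est gamma_gt1 gcs.
have VhW : {subset Vh <= W} by exact: add_subspacer.
have li := op_inv_linear leps eps_gt0 eps_surj.
have iC := op_inv_sym leps eps_gt0 eps_surj epsC.
have i_gt0 := op_inv_gt0 leps eps_gt0 eps_surj.
have ef_sym := energy_form_symmetric T aC lB BD iC leta etaC.
have ef_gt0 := energy_form_gt0 a_ge0 a_co BD i_gt0 eta_gt0.
have ef_ge0 := energy_form_ge0 T a_ge0 BD i_gt0 eta_gt0.
have nf_sym := nitsche_form_symmetric T aC lB li iC.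
have nf_co := nitsche_form_coercive BD i_gt0 eta_gt0 gamma_gt1 gcs VhW inv_est.
have nf_bd := nitsche_form_bounded aC a_ge0 BD iC i_gt0 eta_gt0
  gamma_gt1 gcs.
have gammaV_lt1 : gamma^-1 < 1 by rewrite invf_lt1 ?(lt_trans ltr01).
have c_gt0 : 0 < (1 - gamma^-1) / 2 by rewrite divr_gt0 ?subr_gt0.
split.
  apply: (lax_milgram_on (l := fun v => f v - B v g + eps_inv (T v) g) fVh
    (symmetric_form_onW VhW nf_sym)).
    move=> v vVh v0; apply: lt_le_trans (nf_co _ vVh).
    by rewrite mulr_gt0// ef_gt0// VhW.
  move=> c x y /VhW xW /VhW yW.
  rewrite /eps_inv dual_linear lB// (linearP T) li !dualD !dualZ.
  by rewrite /GRing.scale/=; ring.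
move=> u uh uM uVt [uhVh uh_sol].
have uW : u \in W by exact: add_subspacel.
have [v0 [v0Vh v0_min]] := best_approximation_on VhW uW fVh ef_sym ef_gt0.
exists v0; split=> //.
  by move=> v vVh; rewrite /norm /energy_norm ler_wsqrtr//; exact: v0_min.
have -> : 2 / (1 - 1 / gamma) = ((1 - gamma^-1) / 2)^-1.
  by rewrite invf_div div1r.
apply: (cea_on VhW uW uhVh ef_sym ef_ge0 nf_sym nf_bd c_gt0 nf_co) => // v vVh.
(* Consistency: Green's identity cancels the term [B u (T v)] and leaves L u = f, and T u = g turns
   the other terms into the discrete right-hand side. *)
rewrite uh_sol// /nitsche_form green// (EL _ uM uVt) uM.1 iC; ring.
Qed.
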